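(* Let $p\geq 3$ be a prime and $s$ a positive integer, and let $b$ be a residue class modulo $N_p$ (so $p\mid b$ is well defined). Define $$n_{p,s,b}=\begin{cases}\inf\{n\in\mathbb{N}:(p-1)p^{s(n+1)/2-1}>n+1\},& p\mid b,\\ \inf\{n\in\mathbb{N}:p^{s(n+1)/2-1}>n+1\},&\text{otherwise.}\end{cases}$$ Then for all $n\geq n_{p,s,b}$ we have $M_{p,s,n}(b)>0$ if $p\mid b$, and $M_{p,s,n}(b)<0$ otherwise.
   Context: For a positive integer $n$, put $N_p=(n+1)p$ and $D_p=\{x\in\mathbb{Z}:1\leq x\leq pn+p-1,\ p\nmid x\}$, and for $b\in\mathbb{Z}_{N_p}$ let $M_{p,s,n}(b)=\sum (-1)^{|V_1|+\cdots+|V_s|}$, the sum over all $s$-tuples $(V_1,\ldots,V_s)$ of subsets of $D_p$ with $\sum_{i=1}^s\sum_{x\in V_i}x\equiv b\pmod{N_p}$. Equivalently, $M_{p,s,n}(b)$ is the sum of the coefficients of $q^i$, $i\equiv b\pmod{N_p}$, in $\prod_{j=0}^n\prod_{k=1}^{p-1}(1-q^{pj+k})^s$. *)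

(* Defs.v *)
From HB Require Import structures.
From mathcomp Require Import all_boot all_order all_algebra.
From mathcomp Require Import all_classical all_reals all_analysis.

Set Implicit Arguments.
Unset Strict Implicit.
Unset Printing Implicit Defensive.

Import Order.TTheory GRing.Theory Num.Theory.

Local Open Scope ring_scope.

Definition modulus (p n : nat) : nat := (n.+1 * p)%N.

(* Since p * n + p - 1 = modulus p n - 1, the ordinals below [modulus p n]
   already contain every admissible element. *)
Definition D (p n : nat) : {set 'I_(modulus p n)} :=
  [set x : 'I_(modulus p n) | (1 <= x <= p * n + p - 1)%N && ~~ (p %| x)%N].

(* A residue class modulo [modulus p n] is given by an arbitrary integer
   representative b; the value only depends on b modulo [modulus p n]. *)
Definition M (p s n : nat) (b : int) : int :=
  \sum_(V : s.-tuple {set 'I_(modulus p n)} |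
      [forall i : 'I_s, tnth V i \subset D p n] &&
      (\sum_(i < s) \sum_(x in tnth V i) (val x)%:Z == b %[mod (modulus p n)%:Z])%Z)
    (-1) ^+ (\sum_(i < s) #|tnth V i|)%N.

(* For p >= 3 and s >= 1 both sets below are nonempty (and bounded below by 0),
   so the default value of [inf] on sets without an infimum plays no role. *)
Definition threshold (R : realType) (p s : nat) (b : int) : R :=
  if (p%:Z %| b)%Z then
    inf [set (m%:R : R) | m in [set m : nat |
      (p%:R - 1) * (p%:R : R) `^ ((s%:R * (m%:R + 1)) / 2 - 1) > m%:R + 1]]%classic
  else
    inf [set (m%:R : R) | m in [set m : nat |
      (p%:R : R) `^ ((s%:R * (m%:R + 1)) / 2 - 1) > m%:R + 1]]%classic.

(* Main.v *)
(**
Let N = (n+1)p, z a primitive N-th root of unity, and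
P_k = \prod_(x in D) (1 - z^(kx)). Expanding the product and using the
orthogonality of the characters of Z/N gives
N * M(b) = \sum_(k < N) z^(-kb) P_k^s. If w has order d = pe, dividing
(Y^d - 1) = \prod_(i < d) (Y - w^i) by (Y^e - 1) and evaluating at Y = 1 shows
that the factors with p not dividing i multiply to p; hence P_k = p^g with
g = gcd(k, N) when g divides n+1, while P_k contains a vanishing factor
otherwise. The k that are multiples of n+1 contribute p^(s(n+1)) times p - 1 or
-1, according to whether p divides b. Every other term has g <= (n+1)/2, so
these terms, fewer than N in number, add up to less than N p^(s(n+1)/2) in
absolute value. The main term dominates once N <= (p-1) p^(s(n+1)/2), resp.
N <= p^(s(n+1)/2). The first always holds; the second is, once strict,
inherited by larger n, so that it can be tested at the infimum.
*)
Require Import Defs.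
From HB Require Import structures.
From mathcomp Require Import all_boot all_order all_algebra all_field.
From mathcomp Require Import all_classical all_reals all_analysis.
From mathcomp Require Import zify ring.

Set Implicit Arguments.
Unset Strict Implicit.
Unset Printing Implicit Defensive.

Import Order.TTheory GRing.Theory Num.Theory.

Local Open Scope ring_scope.

(** * Fourier expansion of the signed count *)

Lemma prodr_add1_subset (R : comNzRingType) (T : finType) (A : {set T})
    (F : T -> R) :
  \prod_(i in A) (1 + F i) =
  \sum_(J : {set T} | J \subset A) \prod_(i in J) F i.
Proof.
pose G i := if i \in A then F i else 0.
have -> : \prod_(i in A) (1 + F i) = \prod_i (G i + 1).
  rewrite big_mkcond; apply: eq_bigr => i _; rewrite /G.
  by case: ifP => _; rewrite ?add0r // addrC.
rewrite bigA_distr [RHS]big_mkcond; apply: eq_bigr => J _.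
case: ifPn => [/fintype.subsetP sJA|/subsetPn[x xJ xA]].
  rewrite [RHS]big_mkcond; apply: eq_bigr => i _.
  by rewrite /G; case: ifPn => // /sJA ->.
by rewrite (bigD1 x) //= xJ /G (negbTE xA) mul0r.
Qed.

Lemma sum_prim_root_exp (R : idomainType) (N m : nat) (z : R) :
  N.-primitive_root z ->
  \sum_(k < N) z ^+ (k * m) = if (N %| m)%N then N%:R else 0.
Proof.
move=> zN; under eq_bigr => k _ do rewrite mulnC exprM.
case: ifPn => [|Nm].
  rewrite (prim_order_dvd zN) => /eqP ->.
  by under eq_bigr => k _ do rewrite expr1n; rewrite sumr_const card_ord.
have zm1 : z ^+ m - 1 != 0 by rewrite subr_eq0 -(prim_order_dvd zN).
apply: (mulfI zm1); rewrite mulr0 -subrX1 -exprM mulnC exprM.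
by rewrite (prim_expr_order zN) expr1n subrr.
Qed.

(** Distributivity turns the [s]-th power into a signed sum over [s]-tuples of subsets; summing over
    [k] first then detects the congruence. The natural number [c] represents [-b], which keeps all
    exponents natural. *)
Lemma M_fourier (R : idomainType) (p s n c : nat) (b : int) (z : R) :
    (modulus p n).-primitive_root z ->
    ((modulus p n)%:Z %| c%:Z + b)%Z ->
  (modulus p n)%:R * (M p s n b)%:~R =
  \sum_(k < modulus p n)
    z ^+ (k * c) * (\prod_(x in D p n) (1 - z ^+ (k * x))) ^+ s.
Proof.
set N := modulus p n => zN Ncb.
pose SS (f : {ffun 'I_s -> {set 'I_N}}) : nat := (\sum_i \sum_(x in f i) x)%N.
pose sg (f : {ffun 'I_s -> {set 'I_N}}) : nat := (\sum_i #|f i|)%N.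
have powE (k : nat) :
    (\prod_(x in D p n) (1 - z ^+ (k * x))) ^+ s =
    \sum_(f in ffun_on [pred J : {set 'I_N} | J \subset D p n])
      (-1) ^+ sg f * z ^+ (k * SS f) :> R.
  rewrite prodr_add1_subset -[X in _ ^+ X]card_ord -prodr_const.
  rewrite bigA_distr_big; apply: eq_bigr => f _.
  rewrite /sg -prodrXr /SS big_distrr -prodrXr -big_split.
  apply: eq_bigr => i _ /=.
  rewrite big_distrr -prodrXr -prodr_const -big_split.
  apply: eq_bigr => x _ /=.
  by rewrite mulN1r.
under eq_bigr => k _ do rewrite powE big_distrr.
rewrite exchange_big /= /M rmorph_sum mulr_sumr.
pose tup (f : {ffun 'I_s -> {set 'I_N}}) := [tuple f i | i < s].
rewrite (reindex tup) /=; last first.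
  exists (fun t => [ffun i => tnth t i]) => [f|t] _.
    by apply/ffunP => i; rewrite ffunE tnth_mktuple.
  by apply: eq_from_tnth => i; rewrite tnth_mktuple ffunE.
rewrite big_mkcondr [LHS]big_mkcond [RHS]big_mkcond; apply: eq_bigr => f _.
have -> : [forall i, tnth (tup f) i \subset D p n] =
          (f \in ffun_on [pred J : {set 'I_N} | J \subset D p n]).
  apply/forallP/ffun_onP => H i; have := H i;
  by rewrite tnth_mktuple inE.
case: ifP => // _.
have -> : \sum_(i < s) \sum_(x in tnth (tup f) i) (val x)%:Z = SS f.
  rewrite /SS (big_morph Posz PoszD (erefl _)); apply: eq_bigr => i _.
  by rewrite tnth_mktuple (big_morph Posz PoszD (erefl _)).
have -> : (\sum_(i < s) #|tnth (tup f) i|)%N = sg f.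
  by apply: eq_bigr => i _; rewrite tnth_mktuple.
have -> : (SS f == b %[mod N])%Z = (N %| c + SS f)%N.
  rewrite eqz_mod_dvd -(rpredDr _ Ncb).
  by rewrite [c%:Z + b]addrC addrA subrK -PoszD addnC.
transitivity ((-1) ^+ sg f * \sum_(k < N) z ^+ (k * (c + SS f)) : R).
  rewrite (sum_prim_root_exp _ zN); case: ifP => _; last by rewrite mulr0.
  by rewrite rmorphXn rmorphN1 mulrC.
rewrite mulr_sumr; apply: eq_bigr => k _.
by rewrite mulnDr exprD; ring.
Qed.

(** * Products over [D] at roots of unity *)

Lemma big_nat_dvd (R : Type) (idx : R) (op : Monoid.law idx) (m d : nat)
    (F : nat -> R) : (0 < d)%N ->
  \big[op/idx]_(0 <= i < m * d | (d %| i)%N) F i =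
  \big[op/idx]_(0 <= i < m) F (i * d)%N.
Proof.
(* In each block of [d] consecutive indices only the first is a multiple of [d]. *)
move=> d0; rewrite big_mkcond big_nat_mul; apply: eq_bigr => i _.
rewrite big_ltn ?ltn_pmul2r // dvdn_mull // big1_seq ?Monoid.mulm1 //.
move=> j /=; rewrite mem_index_iota; case: ifP => // /dvdnP[q ->].
by rewrite !ltn_pmul2r // ltnS => /andP[iq]; rewrite leqNgt iq.
Qed.

Lemma prod_ndvd_prim_root (F : fieldType) (p e : nat) (w : F) :
    (0 < p)%N -> (0 < e)%N -> (p * e)%N.-primitive_root w ->
  \prod_(0 <= i < p * e | ~~ (p %| i)%N) (1 - w ^+ i) = p%:R.
Proof.
move=> p0 e0 wpe.
have wpe' : e.-primitive_root (w ^+ p).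
  have := exp_prim_root wpe p; rewrite (gcdn_idPl (dvdn_mulr e (dvdnn p))).
  by rewrite mulKn.
pose Q : {poly F} := \prod_(0 <= i < p * e | ~~ (p %| i)%N) ('X - (w ^+ i)%:P).
have QE : Q = \sum_(j < p) 'X^e ^+ j.
  have nz : 'X^e - 1 != 0 :> {poly F} by rewrite -size_poly_eq0 size_XnsubC.
  apply: (mulfI nz); rewrite -subrX1 -exprM mulnC -(factor_Xn_sub_1 wpe).
  rewrite -(factor_Xn_sub_1 wpe') [RHS](bigID (fun i => p %| i)%N) /=.
  congr (_ * _); rewrite mulnC big_nat_dvd //.
  by apply: eq_bigr => i _; rewrite mulnC exprM.
transitivity (Q.[1]).
  by rewrite horner_prod; apply: eq_bigr => i _; rewrite hornerXsubC.
rewrite QE horner_sum; under eq_bigr => j _ do rewrite !hornerE !expr1n.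
by rewrite sumr_const card_ord.
Qed.

Lemma mem_D (p n : nat) (x : 'I_(modulus p n)) :
  (x \in D p n) = ~~ (p %| x)%N.
Proof.
rewrite inE; case: (boolP (p %| x)%N) => px /=; rewrite ?andbF // andbT.
have x0 : (0 < x)%N by apply: contraNT px; rewrite -eqn0Ngt => /eqP ->.
by have := ltn_ord x; rewrite {2}/modulus; nia.
Qed.

(** The order of [z ^+ k] is N/g with g the gcd. If n+1 = eg, then N = g(pe) and the product runs
    over g periods of length pe, each contributing p. Otherwise p does not divide N/g, so N/g lies
    in [D] and its factor is zero. *)
Lemma prod_D_prim_root (F : fieldType) (p n k : nat) (z : F) :
    (0 < p)%N -> (modulus p n).-primitive_root z ->
  \prod_(x in D p n) (1 - z ^+ (k * x)) =
  if (gcdn k (modulus p n) %| n.+1)%N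
  then p%:R ^+ gcdn k (modulus p n) else 0.
Proof.
set N := modulus p n => p0 zN; set g := gcdn k N.
have N0 : (0 < N)%N by exact: prim_order_gt0 zN.
have g0 : (0 < g)%N by rewrite gcdn_gt0 N0 orbT.
have gN : (g %| N)%N by exact: dvdn_gcdr.
have wd : (N %/ g).-primitive_root (z ^+ k) := exp_prim_root zN k.
case: ifPn => [/dvdnP[e ne]|gn].
  have e0 : (0 < e)%N by case: e ne.
  have NE : N = (g * (p * e))%N by rewrite /N /modulus ne; ring.
  rewrite NE mulKn // in wd.
  under eq_bigl => x do rewrite mem_D.
  rewrite -(big_mkord (fun x => ~~ (p %| x)%N) (fun x => 1 - z ^+ (k * x))).
  rewrite NE big_mkcond big_nat_mul -[g in RHS]subn0 -prodr_const_nat.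
  apply: eq_bigr => i _; rewrite -[(i * _)%N]add0n big_addn mulSn addnK.
  rewrite -(prod_ndvd_prim_root p0 e0 wd) [RHS]big_mkcond /=.
  apply: eq_bigr => j _; rewrite dvdn_addl; last exact/dvdn_mull/dvdn_mulr.
  by rewrite exprM exprD mulnC exprM (prim_expr_order wd) expr1n mulr1.
have pd : ~~ (p %| N %/ g)%N.
  by apply: contra gn; rewrite dvdn_divRL // /N /modulus mulnC dvdn_pmul2r.
have dN : (N %/ g < N)%N.
  rewrite ltn_neqAle leq_div // andbT; apply: contra pd => /eqP ->.
  by rewrite dvdn_mull.
rewrite (bigD1 (Ordinal dN)) ?mem_D //=.
by rewrite exprM (prim_expr_order wd) subrr mul0r.
Qed.

(** * Threshold inequalities *)

(* The threshold inequalities are compared in squared form, multiplied by p, so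
   that the half-integral exponents disappear. *)
Lemma threshold_dvd_ineq (p s m : nat) :
  (3 <= p)%N -> (0 < s)%N ->
  ((m.+1 * p) ^ 2 <= (p - 1) ^ 2 * p ^ (s * m.+1))%N.
Proof.
move=> p3 s0.
apply: (@leq_trans ((p - 1) ^ 2 * p ^ m.+1)); last first.
  by rewrite leq_mul2l leq_pexp2l ?orbT ?leq_pmull //; lia.
(* The induction starts at 1: its step needs (m+2)^2 <= p(m+1)^2, which fails for m = 0 and p =
   3. *)
case: m => [|m]; first by rewrite expn1; nia.
elim: m => [|m IH]; first by rewrite expnMn leq_mul2r leq_sqr; lia.
rewrite [X in (_ <= _ * X)%N]expnS; nia.
Qed.

Lemma sqr_mul_ltn_exp6 (p a : nat) :
  (3 <= p)%N -> (a <= 8)%N -> ((a * p) ^ 2 < p ^ 6)%N.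
Proof.
move=> p3 a8; rewrite expnMn -[6%N]/(4 + 2)%N expnD ltn_mul2r.
rewrite expn_gt0; apply/andP; split; first by lia.
apply: (@leq_ltn_trans (8 ^ 2)); first by rewrite leq_exp2r.
by apply: (@leq_trans (3 ^ 4)); rewrite ?leq_exp2r.
Qed.

(** For m >= 1 the left side grows by a factor of at most 9/4, the right side by p^s >= 3. For m = 0
    the left factor is 4, but the hypothesis p^2 < p^s forces s >= 3. *)
Lemma threshold_ndvd_step (p s m : nat) :
  (3 <= p)%N -> (0 < s)%N ->
  ((m.+1 * p) ^ 2 < p ^ (s * m.+1))%N -> ((m.+2 * p) ^ 2 < p ^ (s * m.+2))%N.
Proof.
move=> p3 s0; case: m => [|m] H.
  have s3 : (3 <= s)%N.
    by move: H; rewrite mul1n muln1 ltn_exp2l //; lia.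
  by apply: (leq_trans (sqr_mul_ltn_exp6 p3 _)) => //; rewrite leq_pexp2l; lia.
rewrite [(s * _)%N]mulnS expnD.
have ps : (3 <= p ^ s)%N.
  by apply: (leq_trans p3); rewrite -{1}[p]expn1 leq_pexp2l //; lia.
apply: (@leq_ltn_trans (3 * (m.+2 * p) ^ 2)).
  by rewrite !expnMn mulnA leq_mul2r; apply/orP; right; nia.
apply: (@leq_trans (3 * p ^ (s * m.+2))); rewrite ?ltn_pmul2l //.
by rewrite leq_mul2r ps orbT.
Qed.

Lemma threshold_ndvd_mono (p s m n : nat) :
  (3 <= p)%N -> (0 < s)%N -> (m <= n)%N ->
  ((m.+1 * p) ^ 2 < p ^ (s * m.+1))%N -> ((n.+1 * p) ^ 2 < p ^ (s * n.+1))%N.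
Proof.
move=> p3 s0 /subnKC <-; elim: (n - m)%N => [|k IH] H; first by rewrite addn0.
by rewrite addnS; apply: threshold_ndvd_step => //; apply: IH.
Qed.

Lemma threshold_ndvd_exists (p s : nat) : (3 <= p)%N -> (0 < s)%N ->
  ((6 * p) ^ 2 < p ^ (s * 6))%N.
Proof.
move=> p3 s0; apply: (leq_trans (sqr_mul_ltn_exp6 p3 _)) => //.
by rewrite leq_pexp2l; lia.
Qed.

Lemma threshold_ndvdE (R : realType) (p s m : nat) : (0 < p)%N ->
  (m%:R + 1 < (p%:R : R) `^ ((s%:R * (m%:R + 1)) / 2 - 1)) =
  ((m.+1 * p) ^ 2 < p ^ (s * m.+1))%N.
Proof.
move=> p0; have p0R : 0 < p%:R :> R by rewrite ltr0n.
set t := (_ / 2 - 1).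
rewrite -ltr_sqr ?nnegrE ?powR_ge0 ?addr_ge0 ?ler0n //.
have tE : (p%:R `^ t) ^+ 2 * p%:R ^+ 2 = (p ^ (s * m.+1))%:R :> R.
  rewrite -!powR_mulrn ?ler0n ?powR_ge0 // -powRrM -powRD; last first.
    by rewrite (gt_eqF p0R) implybT.
  rewrite natrX -powR_mulrn ?ler0n //; congr (_ `^ _).
  by rewrite /t natrM -[m.+1]addn1 natrD; field.
rewrite -(ltr_pM2r (exprn_gt0 2 p0R)) tE natr1 -exprMn -natrM -natrX.
by rewrite ltr_nat.
Qed.

(** If the inequality failed at [n], monotonicity would put every admissible [m] above [n], so the
    infimum would be at least n+1. *)
Lemma threshold_ndvd (R : realType) (p s n : nat) (b : int) :
    (3 <= p)%N -> (0 < s)%N -> ~~ (p%:Z %| b)%Z ->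
    threshold R p s b <= n%:R ->
  ((n.+1 * p) ^ 2 < p ^ (s * n.+1))%N.
Proof.
move=> p3 s0 pb; rewrite /threshold (negbTE pb) => len.
apply: contraTT len => nin; rewrite -ltNge.
have p0 : (0 < p)%N by lia.
apply: (@lt_le_trans _ _ n.+1%:R); first by rewrite ltr_nat.
apply: lb_le_inf.
  (* The infimum is meaningful only for a nonempty set; 5 belongs to it for all p >= 3 and s >= 1,
     since 6^2 < 3^4. *)
  exists 5%:R; exists 5%N => //=.
  by rewrite threshold_ndvdE //; apply: threshold_ndvd_exists.
move=> _ [m /= + <-]; rewrite threshold_ndvdE // => mP.
rewrite ler_nat ltnNge; apply: contra nin => mn.
exact: threshold_ndvd_mono mP.
Qed.

(** * Main term, error bound and sign *)

Lemma modulus_M_approx (p s n : nat) (b : int) : prime p -> (0 < s)%N ->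
  exists2 E : algC,
    (modulus p n)%:R * (M p s n b)%:~R =
      p%:R ^+ (s * n.+1) * (if (p%:Z %| b)%Z then p%:R - 1 else - 1) + E
  & `|E| < (modulus p n)%:R * sqrtC (p%:R ^+ (s * n.+1)).
Proof.
move=> p_pr s0; have p0 := prime_gt0 p_pr; have p1 := prime_gt1 p_pr.
set N := modulus p n; have N0 : (0 < N)%N by rewrite muln_gt0.
have [z zN] := C_prim_root_exists N0.
pose c := `|((- b) %% N)%Z|%N.
have Ncb : (N %| c%:Z + b)%Z.
  have -> : c%:Z = ((- b) %% N)%Z.
    by rewrite gez0_abs // modz_ge0 // eqz_nat -lt0n.
  by have /eqP := modz_mod (- b) N; rewrite eqz_mod_dvd opprK.
have pc : (p %| c)%N = (p%:Z %| b)%Z.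
  have pcb : (p %| c%:Z + b)%Z.
    by apply: dvdz_trans Ncb; rewrite dvdzE /= dvdn_mull.
  change ((p%:Z %| c%:Z)%Z = (p%:Z %| b)%Z).
  apply/idP/idP => H; first by rewrite -(rpredDl b H).
  by rewrite -(rpredDr c%:Z H).
rewrite (M_fourier s zN Ncb).
under eq_bigr => k _ do rewrite (prod_D_prim_root _ p0 zN).
rewrite (bigID (fun k : 'I_N => n.+1 %| k)%N) /=.
pose F k : algC := z ^+ (k * c) *
  (if (gcdn k N %| n.+1)%N then p%:R ^+ gcdn k N else 0) ^+ s.
exists (\sum_(k < N | ~~ (n.+1 %| k)%N) F k).
  congr (_ + _); rewrite -(big_mkord (fun k => n.+1 %| k)%N F).
  (* Write k = i(n+1) with i < p. The term i = 0 vanishes: its gcd is N, which does not divide n+1,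
     and s > 0. *)
  rewrite [N]mulnC big_nat_dvd // big_ltn // mul0n {1}/F gcd0n.
  have -> : (N %| n.+1)%N = false by rewrite gtnNdvd // ltn_Pmulr.
  rewrite expr0n gtn_eqF //= mulr0 add0r.
  rewrite big_nat_cond.
  rewrite (eq_bigr (fun i => p%:R ^+ (s * n.+1) * (z ^+ n.+1) ^+ (i * c))).
    rewrite -mulr_sumr -big_nat_cond; congr (_ * _).
    have zp : p.-primitive_root (z ^+ n.+1).
      have := exp_prim_root zN n.+1.
      by rewrite (gcdn_idPl (dvdn_mulr p (dvdnn _))) mulKn.
    (* The sum over 0 < i < p is the full character sum modulo p less its term 1 at i = 0. *)
    have := sum_prim_root_exp c zp.
    rewrite -(big_mkord xpredT (fun k => (z ^+ n.+1) ^+ (k * c))) big_ltn //.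
    rewrite mul0n expr0 pc => /(canRL (addKr _)) ->; rewrite addrC.
    by case: ifP => _; rewrite ?add0r.
  move=> i /andP[/andP[i0 ip] _].
  rewrite /F /N /modulus -[(n.+1 * p)%N]mulnC -muln_gcdl.
  have -> : gcdn i p = 1%N.
    by apply/eqP; rewrite -/(coprime i p) coprime_sym prime_coprime // gtnNdvd.
  by rewrite mul1n dvdnn -!exprM mulrC [(s * _)%N]mulnC mulnCA mulnA.
set T := sqrtC _.
have T0 : 0 < T by rewrite sqrtC_gt0 exprn_gt0 // ltr0n.
have z1 : `|z| = 1.
  apply/eqP; rewrite -(pexpr_eq1 N0) // -normrX.
  by rewrite (prim_expr_order zN) normr1.
have FT k : ~~ (n.+1 %| k)%N -> `|F k| <= T.
  move=> nk; rewrite normrM !normrX z1 expr1n mul1r.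
  case: ifPn => [gn|_]; last first.
    by rewrite normr0 expr0n gtn_eqF // ltW.
  (* A cofactor of 1 would make n+1 divide k, so the cofactor is at least 2. *)
  have g2 : (2 * gcdn k N <= n.+1)%N.
    case/dvdnP: gn => -[|[|e]] ne; [by [] | | by rewrite ne leq_mul2r orbT].
    by case/negP: nk; rewrite ne mul1n dvdn_gcdl.
  rewrite normrX normr_nat -exprM -[X in X <= _]sqrCK ?exprn_ge0 ?ler0n //.
  rewrite ler_sqrtC ?nnegrE ?exprn_ge0 ?ler0n // -exprM.
  by rewrite ler_weXn2l ?ler1n // mulnAC mulnC leq_mul2l mulnC g2 orbT.
apply: le_lt_trans (ler_norm_sum _ _ _) _.
apply: (@le_lt_trans _ _ (\sum_(k < N | ~~ (n.+1 %| k)%N) T)).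
  by apply: ler_sum => k; apply: FT.
rewrite sumr_const -[T *+ _]mulr_natl ltr_pM2r // ltr_nat.
(* Strictness comes from k = 0, which is a multiple of n+1 and hence absent from the error sum. *)
rewrite -[X in (_ < X)%N]card_ord.
apply: proper_card; apply/properP; split; first exact/fintype.subsetP.
by exists (Ordinal N0); rewrite // unfold_in /= dvdn0.
Qed.

Theorem theorem4p2 (R : realType) (p s : nat) (p_prime : prime p)
    (p_ge3 : (3 <= p)%N) (s_gt0 : (0 < s)%N) (b : int) (n : nat)
    (n_gt0 : (0 < n)%N) (n_ge : threshold R p s b <= n%:R) :
  ((p%:Z %| b)%Z -> 0 < M p s n b) /\ (~~ (p%:Z %| b)%Z -> M p s n b < 0).
Proof.
have [E NM ltE] := modulus_M_approx n b p_prime s_gt0.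
set N := (modulus p n)%:R in NM ltE.
have N0 : 0 < N :> algC by rewrite ltr0n muln_gt0 /= prime_gt0.
set A := p%:R ^+ _ in NM ltE; set T := sqrtC A in ltE.
have TE : T ^+ 2 = A by rewrite sqrtCK.
have T0 : 0 < T by rewrite sqrtC_gt0 exprn_gt0 ?ltr0n ?prime_gt0.
have NME :
    E = N * (M p s n b)%:~R - A * (if (p%:Z %| b)%Z then p%:R - 1 else - 1).
  by rewrite NM addrC addKr.
(* As a difference of integers [E] is real, so the bound on its modulus in [algC] gives bounds from
   both sides. *)
have Er : E \is Num.real.
  rewrite NME /N /A; case: ifP => _;
  by rewrite !(rpredB, rpredM, rpredN1, rpredX, rpred_nat, rpred_int, rpred1).
split=> pb; rewrite ?pb ?(negbTE pb) in NM NME.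
  have NT : N <= (p%:R - 1) * T.
    have pT : 0 <= (p%:R - 1) * T.
      by rewrite mulr_ge0 ?subr_ge0 ?ler1n ?prime_gt0 // ltW.
    rewrite -ler_sqr ?nnegrE ?(ltW N0) //.
    rewrite exprMn TE -(natrB algC (prime_gt0 p_prime)) /A.
    rewrite -!natrX -natrM ler_nat.
    exact: threshold_dvd_ineq.
  have : `|E| < (p%:R - 1) * A.
    by apply: lt_le_trans ltE _; rewrite -TE mulrA ler_pM2r.
  rewrite real_ltr_norml // => /andP[+ _].
  by rewrite NME mulrC ltrDr pmulr_rgt0 // ltr0z.
have NT : N <= T.
  rewrite -ler_sqr ?nnegrE ?(ltW N0) ?(ltW T0) // TE /A -!natrX ler_nat.
  exact/ltnW/threshold_ndvd/n_ge.
have : `|E| < A.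
  by apply: lt_le_trans ltE _; rewrite -TE ler_pM2r.
rewrite real_ltr_norml // => /andP[_].
by rewrite NME mulrN1 opprK gtrDr pmulr_rlt0 // ltrz0.
Qed.
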